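(* Let $E$ be an infinite-dimensional reflexive real Banach space with dual $E^*$, let $S=\{x\in E : \|x\|=1\}$, and suppose that $E$ has the Kadec-Klee property. Let $f:S\to E^*$ be a compact function such that $$\inf_{x\in S}\|f(x)\|_{E^*}>0.$$ Then there exists $\hat x\in S$ such that $$f(\hat x)(\hat x)=\|f(\hat x)\|_{E^*}.$$
   Context: An infinite-dimensional real Banach space $E$ with unit sphere $S=\{x\in E:\|x\|=1\}$ is said to have the Kadec-Klee property if for every sequence $\{x_n\}$ in $S$ converging weakly to a point $x\in S$, one has $\lim_{n\to\infty}\|x_n-x\|=0$. A function $\psi:S\to E^*$ (not assumed linear or the restriction of a linear map) is called compact if it is continuous and $\psi(S)$ is relatively compact in $E^*$; here $S$ carries the norm topology of $E$ and $E^*$ carries the topology of the dual norm $\|\cdot\|_{E^*}$. *)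

(* Defs.v *)
From HB Require Import structures.
From mathcomp Require Import all_boot all_order all_algebra.
From mathcomp Require Import all_classical all_reals topology normedtype.

Set Implicit Arguments.
Unset Strict Implicit.
Unset Printing Implicit Defensive.

Import Order.TTheory GRing.Theory Num.Theory.
Import numFieldNormedType.Exports.

Local Open Scope classical_set_scope.
Local Open Scope ring_scope.

Definition dual_pred (R : realType) (E : normedModType R) : {pred E -> R^o} :=
  fun phi => `[< linear phi /\ continuous phi >].

Record dual (R : realType) (E : normedModType R) : Type := Dual {
  dual_fun :> E -> R^o ;
  dual_funP : dual_fun \in @dual_pred R E }.

Section dual_lmodType.
Context (R : realType) (E : normedModType R).

HB.instance Definition _ := [isSub for @dual_fun R E].
HB.instance Definition _ := [Choice of dual E by <:].

Lemma dual_linear (phi : dual E) : linear phi.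
Proof. by have /asboolP[] := dual_funP phi. Qed.

Lemma dual_continuous (phi : dual E) : continuous phi.
Proof. by have /asboolP[] := dual_funP phi. Qed.

HB.instance Definition _ (phi : dual E) :=
  GRing.isLinear.Build R E R^o *:%R (dual_fun phi) (dual_linear phi).

Lemma dual_submod_closed : submod_closed (@dual_pred R E).
Proof.
split.
  apply/asboolP; split; last by move=> x; exact: cvg_cst.
  by move=> a x y; rewrite /GRing.zero /= scaler0 addr0.
move=> a f g /asboolP[lf cf] /asboolP[lg cg]; apply/asboolP; split.
  move=> b x y.
  rewrite !fctE lf lg !scalerDr !scalerA mulrC; exact: addrACA.
move=> x; apply: cvgD; last exact: cg.
by apply: cvgZl_tmp; exact: cf.
Qed.

HB.instance Definition _ :=
  GRing.isSubmodClosed.Build R (E -> R^o) (@dual_pred R E) dual_submod_closed.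
HB.instance Definition _ := [SubChoice_isSubLmodule of dual E by <:].

End dual_lmodType.

Section dual_norm.
Context (R : realType) (E : normedModType R).
Implicit Types phi psi : dual E.

Definition dual_norm phi : R := sup [set `|phi x| | x in [set x : E | `|x| <= 1]].

Lemma dual_has_sup phi : has_sup [set `|phi x| | x in [set x : E | `|x| <= 1]].
Proof.
split; first by exists `|phi 0|, 0 => //=; rewrite normr0 ler01.
have /linear_boundedP/pinfty_ex_gt0[M M0 phiM] :=
  continuous_linear_bounded 0 (@dual_continuous _ _ phi 0).
exists M => _ [x /= x1 <-]; apply: le_trans (phiM x) _.
by rewrite ler_piMr// ltW.
Qed.

Lemma dual_norm_ub phi (x : E) : `|x| <= 1 -> `|phi x| <= dual_norm phi.
Proof.
by move=> x1; apply: sup_upper_bound; [exact: dual_has_sup|exists x].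
Qed.

Lemma dual_norm_le phi (M : R) :
  (forall x : E, `|x| <= 1 -> `|phi x| <= M) -> dual_norm phi <= M.
Proof.
move=> phiM; apply: ge_sup; first by case: (dual_has_sup phi).
by move=> _ [x /= x1 <-]; exact: phiM.
Qed.

Lemma dual_normP phi (x : E) : `|phi x| <= dual_norm phi * `|x|.
Proof.
have [->|x0] := eqVneq x 0; first by rewrite linear0 !normr0 mulr0.
rewrite -ler_pdivrMr ?normr_gt0// mulrC.
have <- : `|phi (`|x|^-1 *: x)| = `|x|^-1 * `|phi x|.
  by rewrite linearZ normrZ normfV normr_id.
by apply: dual_norm_ub; rewrite normfZV.
Qed.

Lemma dual_normD phi psi : dual_norm (phi + psi) <= dual_norm phi + dual_norm psi.
Proof.
apply: dual_norm_le => x x1; apply: le_trans (ler_normD _ _) _.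
by apply: lerD; exact: dual_norm_ub.
Qed.

Lemma dual_norm0_eq0 phi : dual_norm phi = 0 -> phi = 0.
Proof.
move=> phi0; apply/val_inj/funext => x /=.
by apply/eqP; rewrite -normr_le0 -(mul0r `|x|) -phi0; exact: dual_normP.
Qed.

Lemma dual_normZ (a : R) phi : dual_norm (a *: phi) = `|a| * dual_norm phi.
Proof.
have le b psi : dual_norm (b *: psi) <= `|b| * dual_norm psi.
  apply: dual_norm_le => x x1.
  have -> : `|(b *: psi) x| = `|b| * `|psi x| by rewrite -normrM.
  by rewrite ler_wpM2l// dual_norm_ub.
apply/eqP; rewrite eq_le le/=.
have [->|a0] := eqVneq a 0.
  rewrite normr0 mul0r; apply: le_trans (dual_norm_ub _ (_ : `|0| <= 1)) => //.
  by rewrite normr0.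
rewrite -ler_pdivlMl ?normr_gt0// -normfV.
by rewrite -{1}(scale1r phi) -(mulVf a0) -scalerA; exact: le.
Qed.

HB.instance Definition _ :=
  Lmodule_isNormed.Build R (dual E) dual_normD dual_normZ dual_norm0_eq0.

Lemma dual_normE phi :
  `|phi| = sup [set `|phi x| | x in [set x : E | `|x| <= 1]].
Proof. by []. Qed.

End dual_norm.

Section bidual.
Context (R : realType) (E : normedModType R).

Lemma bidual_eval_subproof (x : E) :
  (fun phi : dual E => phi x) \in @dual_pred R (dual E).
Proof.
have lx : linear (fun phi : dual E => phi x : R^o) by [].
apply/asboolP; split=> //.
pose ev : {linear dual E -> R^o} :=
  HB.pack (fun phi : dual E => phi x : R^o) (GRing.isLinear.Build _ _ _ _ _ lx).
apply: (@bounded_linear_continuous _ _ _ ev); apply/linear_boundedP.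
near=> r => phi; apply: le_trans (dual_normP phi x) _.
rewrite mulrC ler_wpM2r ?(normr_ge0 phi)//; near: r.
by apply: nbhs_pinfty_ge; exact: num_real.
Unshelve. all: by end_near. Qed.

Definition bidual_eval (x : E) : dual (dual E) := Dual (bidual_eval_subproof x).

Definition reflexive_space : Prop :=
  forall Phi : dual (dual E), exists x : E, bidual_eval x = Phi.

End bidual.
Arguments reflexive_space {R} E.

Definition infinite_dimensional (K : fieldType) (V : lmodType K) : Prop :=
  ~ exists s : seq V, forall x : V,
      exists c : 'I_(size s) -> K, x = \sum_(i < size s) c i *: s`_i.

Definition sphere (R : realType) (E : normedModType R) : set E :=
  [set x : E | `|x| = 1].
Arguments sphere {R} E.

Definition weak_cvg (R : realType) (E : normedModType R) (u : nat -> E) (x : E) :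
  Prop := forall phi : dual E, phi (u n) @[n --> \oo] --> phi x.

Definition Kadec_Klee (R : realType) (E : normedModType R) : Prop :=
  forall (u : nat -> sphere E) (x : sphere E),
    weak_cvg (fun n => \val (u n)) (\val x) ->
    `|\val (u n) - \val x| @[n --> \oo] --> (0 : R).
Arguments Kadec_Klee {R} E.

(* When X is a set A of a topological space, coerced to a type, its topology is
   the one induced by the inclusion of A. *)
Definition compact_function (X Y : topologicalType) (f : X -> Y) : Prop :=
  continuous f /\ precompact (range f).

(* Main.v *)
Require Import Defs.
From HB Require Import structures.
From mathcomp Require Import finmap.
From mathcomp Require Import all_boot all_order all_algebra.
From mathcomp Require Import zify ring lra.

(** The sphere of an infinite-dimensional space is a retract of the whole space
    ([sphere_retraction]), so [f] extends to a continuous [G : E -> dual E] with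
    the same relatively compact range: precompose [f] with a retraction [r].  It
    remains to find [z] in the closed unit ball with [G z z = |G z|]: since [|G z|]
    is positive, such a [z] has norm one, hence [r z = z] and [z] is the point
    sought.

    Approximately, finite dimensions suffice.  By compactness finitely many
    vectors [x_i] of the unit ball have the property that every functional in the
    closure of the range of [G] is normed up to [e] by one of them.  A variational
    inequality on the convex hull of the [x_i]
    ([finite_variational_inequality]) yields a [z] in that hull with
    [G z (x_i) <= G z z] for all [i], so that [G z z > |G z| - e]
    ([almost_norming]).  The variational inequality has the strength of
    Brouwer's theorem; it is obtained from Scarf's lemma on finite sets with
    several linear orders ([scarf_rainbow]), whose parity argument takes the place
    of Sperner's lemma, dominant sets replacing the simplices of a triangulation.

    Letting [e] tend to 0 gives a sequence [z_n].  Reflexivity provides a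
    subsequence converging weakly to some [y]
    ([weak_sequential_compactness]), and along an ultrafilter [G z_n] converges in
    norm to some [phi].  Then [phi y >= |phi| > 0], which forces [|y| = 1]; moreover
    [|z_n|] tends to 1, so the Kadec-Klee property turns weak convergence into norm
    convergence.  Continuity identifies [phi] with [G y].

    Functionals on [E] come from the Hahn-Banach theorem, proved here by
    exhibiting linear functionals as the minimal sublinear ones. *)

Set Implicit Arguments.
Unset Strict Implicit.
Unset Printing Implicit Defensive.

(** * Scarf's combinatorial lemma *)

(** In Scarf's terms: no point lies above the minimum of [A] in every order.
    Dominant sets play the part of the simplices of a triangulation. *)
Definition dominant (I X : finType) (r : I -> X -> nat) (A : {set X}) : bool :=
  [forall y, exists k, forall a in A, r k y <= r k a].

Definition facets (X : finType) (B : {set X}) : {set {set X}} :=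
  [set B :\ x | x in B].

(** Besides ordinary points, [X] contains one slack element [e k] for each order
    [k], which is the least element of order [k] and lies above all ordinary points
    in the other orders.  Slack elements let sets of size [#|I|] play the role of
    the simplices of a triangulation of all dimensions at once, and colouring
    [e k] by [k] encodes the boundary condition. *)
Section Scarf.
Variables (I X : finType) (r : I -> X -> nat) (e : I -> X) (c : X -> I).
Hypothesis r_inj : forall k, injective (r k).
Hypothesis e_least : forall k x, x != e k -> r k (e k) < r k x.
Hypothesis e_top : forall k i x, x \notin codom e -> i != k -> r k x < r k (e i).
Hypothesis c_e : cancel e c.
Variable x0 : X.
Hypothesis x0_proper : x0 \notin codom e.
Variable i0 : I.

Let e_inj : injective e := can_inj c_e.

(* A room is a dominant set of full size, a door a dominant set with one point
   less that carries every colour except [i0]. *)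
Let door (A : {set X}) := c @: A == [set~ i0].
Let is_door (A : {set X}) := [&& #|A| == #|I|.-1, dominant r A & door A].
Let is_room (B : {set X}) := (#|B| == #|I|) && dominant r B.

Lemma dominantP (A : {set X}) :
  reflect (forall y, exists k, forall a, a \in A -> r k y <= r k a) (dominant r A).
Proof.
apply: (iffP forallP) => h y.
  by have /existsP[k /forall_inP hk] := h y; exists k.
by have [k hk] := h y; apply/existsP; exists k; apply/forall_inP.
Qed.

Lemma dominantS (A B : {set X}) : A \subset B -> dominant r B -> dominant r A.
Proof.
move=> /subsetP AB /dominantP h; apply/dominantP => y.
by have [k hk] := h y; exists k => a /AB; exact: hk.
Qed.

Lemma card_gt0I : 0 < #|I|.
Proof. by apply/card_gt0P; exists i0. Qed.

(** A room with all the colours has one door, obtained by removing the point of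
    colour [i0].  If a room that misses a colour has a door, then it misses only
    [i0], exactly two of its points share a colour, and removing either of them
    gives a door. *)
Lemma room_parity (B : {set X}) : #|B| = #|I| ->
  odd #|[set A in facets B | door A]| = (c @: B == setT).
Proof.
move=> cB.
have facetE A : (A \in [set A in facets B | door A]) =
   [exists x in B, (A == B :\ x) && (c @: (B :\ x) == [set~ i0])].
  rewrite inE; apply/andP/idP => [[/imsetP[x xB ->] dA]|/exists_inP[x xB /andP[/eqP-> d]]].
    by apply/exists_inP; exists x => //; rewrite eqxx.
  by split=> //; apply: imset_f.
have card_facet x : x \in B -> #|B :\ x| = #|I|.-1.
  by move=> xB; rewrite -cB (cardsD1 x B) xB.
have door_inj x : x \in B -> c @: (B :\ x) = [set~ i0] -> {in B :\ x &, injective c}.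
  by move=> xB h; apply/imset_injP; rewrite h cardsC1 card_facet.
have setD1_inj x y : x \in B -> y \in B -> B :\ x = B :\ y -> x = y.
  move=> xB yB h; apply/eqP; apply/negP => /negP xy.
  have : x \in B :\ y by rewrite !inE xy.
  by rewrite -h !inE eqxx.
have [cBT|cBT] := eqVneq (c @: B) setT.
  have cinj : {in B &, injective c} by apply/imset_injP; rewrite cBT cardsT cB.
  have /imsetP[x xB cx] : i0 \in c @: B by rewrite cBT.
  suff -> : [set A in facets B | door A] = [set B :\ x] by rewrite cards1.
  apply/setP => A; rewrite facetE inE; apply/exists_inP/eqP => [[y yB /andP[/eqP-> /eqP h]]|->].
    have [->//|yx] := eqVneq y x.
    have : i0 \in c @: (B :\ y) by rewrite cx imset_f// !inE eq_sym yx.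
    by rewrite h !inE eqxx.
  exists x => //; rewrite eqxx /=; apply/eqP/setP => k; rewrite !inE.
  apply/imsetP/idP => [[y /setD1P[yx yB] ->]|ki0].
    by rewrite cx; apply: contra yx => /eqP /cinj -> //.
  have /imsetP[y yB ky] : k \in c @: B by rewrite cBT.
  by exists y => //; rewrite !inE yB andbT; apply: contra ki0 => /eqP yx; rewrite ky yx cx.
have [->|] := eqVneq [set A in facets B | door A] set0; first by rewrite cards0.
case/set0Pn => A; rewrite facetE => /exists_inP[x xB /andP[_ /eqP dx]] {A}.
have cinj := door_inj _ xB dx.
have cx : c x != i0.
  apply: contra cBT => /eqP cx; apply/eqP/setP => k; rewrite inE.
  have [->|ki0] := eqVneq k i0; first by rewrite -cx imset_f.
  have : k \in c @: (B :\ x) by rewrite dx !inE.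
  by move=> /imsetP[y /setD1P[_ yB] ->]; exact: imset_f.
have /imsetP[y yBx cxy] : c x \in c @: (B :\ x) by rewrite dx !inE.
have /setD1P[yx yB] := yBx.
suff -> : [set A in facets B | door A] = [set B :\ x; B :\ y].
  rewrite cards2; case: eqVneq => // /setD1_inj xy.
  by rewrite xy // eqxx in yx.
apply/setP => A; rewrite facetE !inE.
apply/exists_inP/orP => [[z zB /andP[/eqP-> /eqP dz]]|].
  have [->|zx] := eqVneq z x; first by left.
  have [->|zy] := eqVneq z y; first by right.
  have := door_inj _ zB dz x y; rewrite !inE ![_ == z]eq_sym zx zy xB yB /=.
  by move=> /(_ isT isT cxy) xy; rewrite xy eqxx in yx.
case=> /eqP->; first by exists x => //; rewrite eqxx dx eqxx.
exists y => //; rewrite eqxx -dx /=; apply/eqP/setP => k.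
apply/imsetP/imsetP => -[z /setD1P[zn zB] ->].
  have [->|zx] := eqVneq z x; first by exists y.
  by exists z => //; rewrite !inE zx.
have [->|zy] := eqVneq z y; first by exists x; rewrite // !inE eq_sym yx.
by exists z => //; rewrite !inE zy.
Qed.

Let rooms_of (A : {set X}) := [set B | is_room B & A \in facets B].

Lemma rooms_ofP (A B : {set X}) : #|A| = #|I|.-1 ->
  reflect (exists2 y, y \notin A & B = y |: A /\ dominant r B) (B \in rooms_of A).
Proof.
move=> cA; rewrite inE; apply: (iffP andP).
  move=> [/andP[_ dB] /imsetP[y yB ->]]; exists y; first by rewrite !inE eqxx.
  by rewrite setD1K.
move=> [y yA [-> dB]]; split; last first.
  by apply/imsetP; exists y; rewrite ?setU11// setU1K.
by rewrite /is_room dB cardsU1 yA cA add1n prednK ?card_gt0I ?eqxx.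
Qed.

Let outer : {set X} := e @: [set~ i0].

Lemma card_outer : #|outer| = #|I|.-1.
Proof. by rewrite card_imset // cardsC1. Qed.

(** The door made of slack elements opens only on the room obtained by adding the
    ordinary point that is highest in the order [i0]. *)
Lemma outer_rooms : #|rooms_of outer| = 1.
Proof.
have outer_e x : x \notin codom e -> x \notin outer.
  by apply: contra => /imsetP[i _ ->]; exact: codom_f.
pose M := [arg max_(x > x0 | x \notin codom e) r i0 x].
have [MP Mmax] : M \notin codom e /\ forall x, x \notin codom e -> r i0 x <= r i0 M.
  by rewrite /M; case: arg_maxnP.
have e0 : e i0 \notin outer by rewrite mem_imset // !inE eqxx.
suff -> : rooms_of outer = [set M |: outer] by rewrite cards1.
apply/setP => B; rewrite inE; apply/(rooms_ofP _ card_outer)/eqP => [[y yo [-> dB]]|->].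
  have [k hk] := dominantP _ dB M.
  have [ki0|ki0] := eqVneq k i0; last first.
    have := hk (e k); rewrite setU1r ?mem_imset ?inE // => /(_ isT).
    rewrite leqNgt e_least //; apply: contra MP => /eqP ->; exact: codom_f.
  rewrite {}ki0 {k} in hk.
  have [ye|yne] := boolP (y \in codom e).
    have {}ye : y = e i0.
      case/codomP: ye yo => i -> io; congr e; apply/eqP; apply: contraNT io => ii0.
      by rewrite mem_imset // !inE.
    have := hk y (setU11 _ _); rewrite ye leqNgt e_least //.
    apply: contra MP => /eqP ->; exact: codom_f.
  suff -> : y = M by [].
  by apply: (@r_inj i0); apply/eqP; rewrite eqn_leq Mmax //= hk ?setU11.
exists M; first exact: outer_e.
split => //; apply/dominantP => y.
have [/codomP[k ->]|yne] := boolP (y \in codom e).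
  by exists k => a _; have [->//|ae] := eqVneq a (e k); exact/ltnW/e_least.
exists i0 => a /setU1P[->|/imsetP[i ii0 ->]]; first exact: Mmax.
by apply/ltnW/e_top => //; rewrite !inE in ii0.
Qed.

Let lowest a0 (A : {set X}) k := [arg min_(a < a0 in A) r k a].

Lemma lowestP a0 (A : {set X}) k : a0 \in A ->
  lowest a0 A k \in A /\ forall a, a \in A -> r k (lowest a0 A k) <= r k a.
Proof.
by move=> a0A; rewrite /lowest; case: arg_minnP => // a aA h; split.
Qed.

Lemma lowest_uniq a0 (A : {set X}) k y : y \in A -> (forall a, a \in A -> r k y <= r k a) ->
  a0 \in A -> lowest a0 A k = y.
Proof.
move=> yA h /(lowestP k)[mA mle]; apply: (@r_inj k); apply/eqP.
by rewrite eqn_leq h // mle.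
Qed.

Lemma lowest_image a0 (A : {set X}) : a0 \in A -> dominant r A -> lowest a0 A @: setT = A.
Proof.
move=> a0A /dominantP dA; apply/setP => y; apply/imsetP/idP => [[k _ ->]|yA].
  by have [] := lowestP k a0A.
by have [k hk] := dA y; exists k; rewrite ?inE // (lowest_uniq _ hk).
Qed.

(** A door [A] with an ordinary point has [#|I| - 1] elements, each the lowest of
    [A] in some of the [#|I|] orders, so that exactly two orders [i] and [j] have
    the same lowest element.  A point can be added to [A] without destroying
    dominance only by becoming the lowest one in the order [i] or in the order [j],
    and in each case only the highest candidate is possible. *)
Lemma inner_rooms (A : {set X}) : is_door A -> A != outer -> #|rooms_of A| = 2.
Proof.
move=> /and3P[/eqP cA dA /eqP cAi0] Aouter.
have [t tA tne] : exists2 t, t \in A & t \notin codom e.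
  apply/exists_inP; apply: contraR Aouter => /exists_inPn Ae.
  rewrite eqEcard card_outer cA leqnn andbT; apply/subsetP => a aA.
  have /codomP[i ai] : a \in codom e by move: (Ae _ aA); rewrite negbK.
  rewrite ai mem_imset // -cAi0 -(c_e i) -ai; exact: imset_f.
pose m := lowest t A.
have mA k : m k \in A by have [] := lowestP k tA.
have mle k a : a \in A -> r k (m k) <= r k a by have [_] := lowestP k tA; apply.
have mT : m @: setT = A by exact: lowest_image.
have m_e l i : m l = e i -> i = l.
  move=> mli; apply/eqP; apply/negPn/negP => il.
  by have := mle l t tA; rewrite mli leqNgt e_top.
have [i [j [ij mij]]] : exists i j, i != j /\ m i = m j.
  have /injectivePn[i [j ij mij]] : ~~ injectiveb m.
    apply/negP => /injectiveP /card_imset-/(_ setT).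
    by move/eqP; rewrite mT cA cardsT -{2}(prednK card_gt0I) ltn_eqF.
  by exists i, j.
pose M i' := [set y | [forall (l | l != i'), r l (m l) < r l y]].
have MP i' y : reflect (forall l, l != i' -> r l (m l) < r l y) (y \in M i').
  by rewrite inE; apply: forall_inP.
have M_A i' j' y : i' != j' -> m i' = m j' -> y \in M i' -> y \notin A.
  move=> ij' mij' /MP yM; apply/negP; rewrite -mT => /imsetP[k _ yk].
  have [ki|ki] := eqVneq k i'; last by have := yM k ki; rewrite yk ltnn.
  by have := yM j'; rewrite eq_sym ij' yk ki mij' ltnn => /(_ isT).
have e_M i' j' : i' != j' -> m i' = m j' -> e i' \in M i'.
  move=> ij' mij'; apply/MP => l li'.
  have [/codomP[k mk]|mne] := boolP (m l \in codom e); last by rewrite e_top // eq_sym.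
  have kl := m_e _ _ mk; rewrite mk kl e_least //.
  by apply: contra li' => /eqP/e_inj ->.
(* The candidates for becoming the lowest point in the order [i'] are the elements
   of [M i']; the slack element [e i'] is one of them. *)
pose top i' := [arg max_(y > e i' in M i') r i' y].
have topP i' j' : i' != j' -> m i' = m j' ->
    [/\ top i' \in M i', top i' \notin A,
        dominant r (top i' |: A), r i' (top i') < r i' (m i') &
        forall y, y \in M i' -> r i' y <= r i' (top i')].
  move=> ij' mij'; rewrite /top.
  case: arg_maxnP => [|y yM ymax]; first exact: e_M mij'.
  have yA : y \notin A by exact: M_A mij' yM.
  have ylt : r i' y < r i' (m i').
    have [k hk] := dominantP _ dA y.
    have ki : k = i'.
      apply/eqP; apply/negPn/negP => /(MP _ _ yM).
      by rewrite ltnNge hk.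
    rewrite {}ki {k} in hk; rewrite ltn_neqAle hk ?mA // andbT.
    by apply: contra yA => /eqP/r_inj ->.
  split => //; apply/dominantP => w.
  have [wM|] := boolP (w \in M i').
    exists i' => a /setU1P[->|aA]; first exact: ymax.
    by apply: leq_trans (ymax _ wM) _; apply: leq_trans (ltnW ylt) _; exact: mle.
  rewrite inE negb_forall_in => /exists_inP[l li]; rewrite -leqNgt => wl.
  exists l => a /setU1P[->|aA]; last exact: leq_trans wl (mle _ _ aA).
  exact: leq_trans wl (ltnW (MP _ _ yM _ li)).
have ji : j != i by rewrite eq_sym.
have [tiM tiA tid tilt timax] := topP _ _ ij mij.
have [tjM tjA tjd tjlt tjmax] := topP _ _ ji (esym mij).
have tij : top i != top j.
  apply/eqP => tij; have := MP _ _ tjM _ ij.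
  by rewrite -tij ltnNge (ltnW tilt).
suff -> : rooms_of A = [set top i |: A; top j |: A].
  rewrite cards2; case: eqVneq => // tt.
  have : top i \in top j |: A by rewrite -tt setU11.
  by rewrite !inE (negPf tij) (negPf tiA).
apply/setP => B; apply/(rooms_ofP _ cA)/set2P => [|[]->]; last first.
- by exists (top j).
- by exists (top i).
move=> [y yA [-> dB]].
have yB := setU11 y A.
pose mu := lowest y (y |: A).
have muT : mu @: setT = y |: A by exact: lowest_image.
have mule k a : a \in y |: A -> r k (mu k) <= r k a.
  by have [_] := lowestP k yB; apply.
have mu_inj : injective mu.
  have /imset_injP muTi : #|mu @: setT| == #|[set: I]|.
    by rewrite muT cardsU1 yA cA add1n prednK ?card_gt0I ?cardsT.
  by move=> k l; apply: muTi; rewrite inE.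
(* [k0] is the only order in which the new point [y] is the lowest. *)
have /imsetP[k0 _ yk0] : y \in mu @: setT by rewrite muT.
have mum l : l != k0 -> mu l = m l.
  move=> lk0; have : mu l \in y |: A by rewrite -muT imset_f.
  move=> /setU1P[|mulA]; first by rewrite yk0 => /mu_inj lk; rewrite lk eqxx in lk0.
  by apply/esym/lowest_uniq => // a aA; apply: mule; rewrite setU1r.
have yM : y \in M k0.
  apply/MP => l lk0; rewrite -mum // ltn_neqAle mule // andbT.
  by apply/eqP => /r_inj; rewrite {1}yk0 => /mu_inj lk; rewrite lk eqxx in lk0.
have ymax z : z \in M k0 -> r k0 z <= r k0 y.
  move=> /MP zM; have [k hk] := dominantP _ dB z.
  have [<-|kk'] := eqVneq k k0; first by rewrite hk.
  by have := zM _ kk'; rewrite ltnNge hk // setU1r.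
have [k0i|k0i] := eqVneq k0 i.
  rewrite {}k0i {k0 yk0 mum} in yM ymax *.
  left; congr (_ |: _); apply: (@r_inj i); apply/eqP.
  by rewrite eqn_leq timax //= ymax.
have [k0j|k0j] := eqVneq k0 j.
  rewrite {}k0j {k0 yk0 mum k0i} in yM ymax *.
  right; congr (_ |: _); apply: (@r_inj j); apply/eqP.
  by rewrite eqn_leq tjmax //= ymax.
have /mu_inj ijE : mu i = mu j by rewrite !mum // eq_sym.
by rewrite ijE eqxx in ij.
Qed.

(** Count the pairs of a door and a room behind it modulo 2.  Only the slack door
    lies in an odd number of rooms, so the total is odd, and only rooms with all
    the colours contribute an odd number. *)
Theorem scarf_rainbow : exists B : {set X}, [/\ #|B| = #|I|, dominant r B & c @: B = setT].
Proof.
have outer_door : is_door outer.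
  apply/and3P; split; first by rewrite card_outer.
    apply/dominantP => y.
    have [/codomP[k ->]|yne] := boolP (y \in codom e).
      by exists k => a _; have [->//|ae] := eqVneq a (e k); exact/ltnW/e_least.
    exists i0 => a /imsetP[i ii0 ->].
    by apply/ltnW/e_top => //; rewrite !inE in ii0.
  apply/eqP/setP => k; apply/imsetP/idP => [[_ /imsetP[i ii0 ->] ->]|kk].
    by rewrite c_e.
  by exists (e k); rewrite ?c_e ?mem_imset.
(* Double counting of the incidences between doors and rooms. *)
have countE : \sum_(A | is_door A) #|rooms_of A| =
    \sum_(B | is_room B) #|[set A in facets B | door A]|.
  under eq_bigr => A _ do rewrite -sum1_card.
  under [RHS]eq_bigr => B _ do rewrite -sum1_card.
  rewrite (exchange_big_dep is_room) /=; last by move=> A B _; rewrite inE => /andP[].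
  apply: eq_bigr => B roomB; apply: eq_bigl => A; rewrite !inE roomB /=.
  have [Af|] := boolP (A \in facets B); last by rewrite andbF.
  rewrite andbT /=; rewrite /is_door; case/andP: roomB => /eqP cB dB.
  have /imsetP[x xB AE] := Af.
  have -> : #|A| == #|I|.-1 by rewrite -cB AE (cardsD1 x B) xB.
  by rewrite (dominantS _ dB) // AE subsetDl.
have odd_sum (P : pred {set X}) (F : {set X} -> nat) :
    odd (\sum_(A | P A) F A) = \big[addb/false]_(A | P A) odd (F A).
  by apply: (big_morph odd) => //; exact: oddD.
have : odd (\sum_(A | is_door A) #|rooms_of A|).
  rewrite (bigD1 outer) //= outer_rooms oddD odd_sum big1 // => A /andP[dA Ao].
  by rewrite inner_rooms.
rewrite countE odd_sum.
have [/existsP[B /andP[/andP[/eqP cB dB] /eqP cT]] _|/existsPn noB] :=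
  boolP [exists B, is_room B && (c @: B == setT)].
  by exists B.
rewrite big1 // => B roomB; have /andP[/eqP cB _] := roomB.
by rewrite room_parity //; apply/negbTE; have := noB B; rewrite roomB.
Qed.

End Scarf.

(** * Nearly equal grid points of all relevant colours *)

Section Grid.
Variables (I : finType) (N : nat).

(** Integer points of the simplex with vertices [N] times the unit vectors. *)
Definition grid := {x : {ffun I -> 'I_N.+1} | \sum_i x i == N}.

(** Order [k] compares the [k]-th coordinates; enumeration ranks break ties, and
    slack elements are given the extreme values. *)
Definition grid_rank (k : I) (x : grid + I) : nat :=
  match x with
  | inl x => ((val x k) * #|{: grid}| + enum_rank x).+1
  | inr i => if i == k then 0 else (N.+1 * #|{: grid}| + enum_rank i).+1
  end.

Lemma grid_rank_lt (k : I) (x : grid) : grid_rank k (inl x) <= N.+1 * #|{: grid}|.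
Proof.
rewrite /grid_rank /=; set n := #|_|.
have := ltn_ord (val x k); have := ltn_ord (enum_rank x); rewrite -/n.
move: (nat_of_ord (enum_rank x)) => a; move: (nat_of_ord (val x k)) => b; nia.
Qed.

Lemma grid_rank_le (k : I) (x y : grid) :
  grid_rank k (inl x) <= grid_rank k (inl y) -> val x k <= val y k.
Proof.
rewrite /grid_rank /=; set n := #|_|.
have := ltn_ord (enum_rank y); rewrite -/n.
move: (nat_of_ord (enum_rank x)) (nat_of_ord (enum_rank y)) => a a'.
move: (nat_of_ord (val x k)) (nat_of_ord (val y k)) => b b'; nia.
Qed.

Lemma grid_rank_inj (k : I) : injective (grid_rank k).
Proof.
have lr x i : grid_rank k (inl x) <> grid_rank k (inr i).
  have := grid_rank_lt k x; rewrite /grid_rank; case: eqP; lia.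
move=> [x|i] [y|j] h.
- have xy : val x k = val y k.
    by apply/val_inj/eqP; rewrite eqn_leq !grid_rank_le ?h.
  move: h; rewrite /grid_rank xy => -[/addnI /val_inj /enum_rank_inj ->] //.
- by case: (lr _ _ h).
- by case: (lr _ _ (esym h)).
- move: h; rewrite /grid_rank; case: eqP => [->|_]; case: eqP => [->|_] //.
  by move=> -[/addnI /val_inj /enum_rank_inj ->].
Qed.

Lemma grid_above (C : {set I}) (m : I -> nat) k0 : k0 \in C ->
  \sum_(k in C) m k <= N -> exists x : grid, forall k, k \in C -> m k <= val x k.
Proof.
move=> k0C mN.
pose y k := if k \in C then m k + (k == k0) * (N - \sum_(k in C) m k) else 0.
have ysum : \sum_k y k = N.
  rewrite (bigID (mem C)) /= [X in _ + X]big1 ?addn0; last first.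
    by move=> k kC; rewrite /y (negPf kC).
  under eq_bigr => k kC do rewrite /y kC.
  rewrite big_split /= -big_distrl /=.
  rewrite [X in _ + X * _](bigD1 k0) //= eqxx [X in (_ + X) * _]big1 ?addn0 ?mul1n ?subnKC //.
  by move=> k /andP[_ /negPf->].
have yN k : y k < N.+1 by rewrite ltnS -ysum (bigD1 k) //= leq_addr.
pose x : {ffun I -> 'I_N.+1} := [ffun k => Ordinal (yN k)].
have sx : \sum_k x k == N.
  by rewrite -[X in _ == X]ysum; apply/eqP/eq_bigr => k _; rewrite ffunE.
exists (exist (fun x : {ffun I -> 'I_N.+1} => \sum_k x k == N) x sx) => k kC.
by rewrite /= ffunE /= /y kC leq_addr.
Qed.

(** In a set given by Scarf's lemma, let [C] be the orders whose slack element is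
    absent and [m k] the least [k]-th coordinate of its points.  Dominance says that
    no grid point exceeds all [m k] with [k] in [C]; hence the sum over [C] of the
    [(m k).+1] exceeds [N], which leaves less than [#|I|] to be shared between the
    excesses over [m] and the coordinates outside [C].  The colours in [C] occur on
    these points because the slack elements carry the other ones. *)
Lemma rainbow_near_point (i0 : I) (c : grid -> I) :
  exists x : grid, forall k, val x k < #|I| \/
    exists2 y, c y = k & forall i, val y i < val x i + #|I| /\ val x i < val y i + #|I|.
Proof.
pose c' (x : grid + I) := match x with inl x => c x | inr i => i end.
have e_notin x : inl x \notin codom (@inr grid I) by apply/codomP => -[].
have [x0 _] : exists x : grid, forall k, k \in [set i0] -> 0 <= val x k.
  by apply: (@grid_above _ (fun=> 0) i0); rewrite ?set11 ?big1.
have [||B [cB /dominantP dB cT]] :=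
  @scarf_rainbow I _ grid_rank inr c' grid_rank_inj _ _ (fun=> erefl) (inl x0) (e_notin x0) i0.
- move=> k [x|i] // h; rewrite /grid_rank eqxx //.
  by case: eqP => // ik; rewrite ik eqxx in h.
- move=> k i [x|j]; last by rewrite codom_f.
  move=> _ ik; apply: leq_ltn_trans (grid_rank_lt k x) _.
  by rewrite /grid_rank (negPf ik) ltnS leq_addr.
pose C := [set k | inr k \notin B].
have dBl (y : grid) : exists2 k, k \in C & forall x, inl x \in B -> val y k <= val x k.
  have [k hk] := dB (inl y); exists k; last by move=> x /hk/grid_rank_le.
  rewrite inE; apply/negP => /hk; by rewrite /= eqxx.
have [k0 k0C _] := dBl x0.
have colC k : k \in C -> exists2 x, inl x \in B & c x = k.
  move=> kC; have /imsetP[[x|i] xB kx] : k \in c' @: B by rewrite cT.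
    by exists x.
  by move: kC; rewrite inE kx /= xB.
have [z zB _] := colC k0 k0C.
pose m k := val [arg min_(x < z | inl x \in B) val x k] k : nat.
have mle k x : inl x \in B -> m k <= val x k.
  by move=> xB; rewrite /m; case: arg_minnP => // y _; apply.
have mB k : exists2 x, inl x \in B & m k = val x k.
  by rewrite /m; case: arg_minnP => // y yB _; exists y.
clearbody m.
(* Otherwise some grid point would exceed all the [m k] with [k] in [C]. *)
have sum_m : N < \sum_(k in C) (m k).+1.
  rewrite ltnNge; apply/negP => /(grid_above k0C)[y hy].
  have [k kC yk] := dBl y; have [x xB mx] := mB k.
  by have := leq_trans (hy k kC) (yk x xB); rewrite mx ltnn.
have cardC : #|C| <= #|I| by exact: max_card.
have inB x i : inl x \in B -> (i \in C -> val x i < m i + #|I|) /\ (i \notin C -> val x i < #|I|).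
  move=> xB; have le k : m k <= val x k by exact: mle.
  have H : \sum_(k in C) val x k + \sum_(k | k \notin C) val x k = N.
    by apply: etrans (eqP (valP x)); rewrite [RHS](bigID (mem C)).
  have sm : \sum_(k in C) (m k).+1 = \sum_(k in C) m k + #|C|.
    by under eq_bigr => k _ do rewrite -addn1; rewrite big_split /= sum1_card.
  have le_sum (P : pred I) : \sum_(k | P k) m k <= \sum_(k | P k) val x k by exact: leq_sum.
  have le1 (P : pred I) (F : I -> nat) : P i ->
    \sum_(k | P k) F k = F i + \sum_(k | P k && (k != i)) F k by exact: bigD1.
  split=> iC.
    move: H sum_m cardC (le_sum (fun k => (k \in C) && (k != i))); rewrite sm !(le1 (mem C)) //=.
    lia.
  move: H sum_m cardC (le_sum (mem C)); rewrite sm (le1 (fun k => k \notin C)) //=.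
  lia.
exists z => k; have [kC|kC] := boolP (k \in C); last by left; apply: (inB z k zB).2.
right; have [y yB cy] := colC k kC; exists y => // i.
have [iC|iC] := boolP (i \in C); last first.
  have zi := (inB z i zB).2 iC; have yi := (inB y i yB).2 iC.
  by split; apply: leq_trans (leq_addl _ _).
have zi := (inB z i zB).1 iC; have yi := (inB y i yB).1 iC.
by split; [apply: leq_trans yi _|apply: leq_trans zi _]; rewrite leq_add2r mle.
Qed.

End Grid.

From mathcomp Require Import all_classical all_reals topology normedtype.

Import Order.TTheory GRing.Theory Num.Theory.
Import numFieldNormedType.Exports.

Local Open Scope classical_set_scope.
Local Open Scope ring_scope.

(** * The Hahn-Banach theorem for sublinear functionals *)

Section HahnBanach.
Context {R : realType} {E : lmodType R}.
Implicit Types (p q : E -> R) (x y w : E).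

(** Positive homogeneity is asked for as an inequality: applied to the inverse of
    the scalar as well, it yields equality. *)
Definition sublinear q :=
  (forall x y, q (x + y) <= q x + q y) /\
  (forall a x, 0 < a -> q (a *: x) <= a * q x).

Lemma sublinear0 q : sublinear q -> q 0 = 0.
Proof.
move=> [_ qZ]; have := qZ 2 0 (ltr0Sn _ _); rewrite scaler0.
have := qZ 2^-1 0; rewrite scaler0 invr_gt0 => /(_ (ltr0Sn _ _)); lra.
Qed.

Lemma sublinearZ q a x : sublinear q -> 0 <= a -> q (a *: x) = a * q x.
Proof.
move=> sq; rewrite le_eqVlt => /predU1P[<-|a0].
  by rewrite scale0r mul0r sublinear0.
apply/eqP; rewrite eq_le sq.2 //= -ler_pdivlMl //.
by rewrite -{1}(scale1r x) -(mulVf (lt0r_neq0 a0)) -scalerA sq.2 // invr_gt0.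
Qed.

Lemma sublinear_geN q x : sublinear q -> - q (- x) <= q x.
Proof. by move=> sq; have := sq.1 x (- x); rewrite subrr sublinear0 //; lra. Qed.

(** For sublinear [q], the largest sublinear functional [q'] below [q] such that
    [q' (- y) <= - q y]. *)
Definition slide q y x : R := inf [set q (x + t *: y) - t * q y | t in [set t | 0 <= t]].

Section Slide.
Variables (q : E -> R) (sq : sublinear q) (y : E).

Lemma slide_lbound x t : 0 <= t -> - q (- x) <= q (x + t *: y) - t * q y.
Proof.
move=> t0; rewrite lerBrDr -(sublinearZ y sq) //.
have := sq.1 (x + t *: y) (- x); rewrite addrAC subrr add0r; lra.
Qed.

Lemma slide_le x t : 0 <= t -> slide q y x <= q (x + t *: y) - t * q y.
Proof.
move=> t0; apply: ge_inf; last by exists t.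
by exists (- q (- x)) => _ [s s0 <-]; exact: slide_lbound.
Qed.

Lemma slide_ge x (m : R) :
  (forall t, 0 <= t -> m <= q (x + t *: y) - t * q y) -> m <= slide q y x.
Proof.
move=> h; apply: lb_le_inf => [|_ [t t0 <-]]; last exact: h.
by exists (q (x + 0 *: y) - 0 * q y), 0 => //=.
Qed.

Lemma slide_sublinear : sublinear (slide q y).
Proof.
split=> [x x'|a x a0].
  rewrite -lerBlDr; apply: slide_ge => t t0; rewrite lerBlDr -lerBlDl.
  apply: slide_ge => s s0; rewrite lerBlDl.
  apply: le_trans (slide_le (x + x') (addr_ge0 t0 s0)) _.
  rewrite scalerDl addrACA; have := sq.1 (x + t *: y) (x' + s *: y); lra.
rewrite -ler_pdivrMl //; apply: slide_ge => t t0; rewrite ler_pdivrMl //.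
apply: le_trans (slide_le _ (mulr_ge0 (ltW a0) t0)) _.
by rewrite -scalerA -scalerDr (sublinearZ _ sq (ltW a0)) mulrBr mulrA.
Qed.

Lemma slide_le_id x : slide q y x <= q x.
Proof. by apply: le_trans (slide_le x (lexx 0)) _; rewrite scale0r addr0 mul0r subr0. Qed.

Lemma slide_opp : slide q y (- y) <= - q y.
Proof.
by apply: le_trans (slide_le _ ler01) _; rewrite scale1r addNr sublinear0 // mul1r sub0r.
Qed.

End Slide.

(** Zorn's lemma applies because the values at [x] of sublinear functionals below
    [p] are bounded below by [- p (- x)], so that the infimum of a chain is finite. *)
Lemma minimal_sublinear p : sublinear p ->
  exists q, [/\ sublinear q, forall x, q x <= p x &
    forall q', sublinear q' -> (forall x, q' x <= q x) -> q' = q].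
Proof.
move=> sp.
pose T := {q : E -> R | sublinear q /\ forall x, q x <= p x}.
pose le (q1 q2 : T) := `[< forall x, sval q2 x <= sval q1 x >].
have lbT (q : T) x : - p (- x) <= sval q x.
  case: q => q [sq qp] /=; apply: le_trans (sublinear_geN _ sq).
  by rewrite lerN2.
have [| | | |[q [sq qp]] qmin] := @Zorn T le.
- by move=> q; apply/asboolP.
- move=> q1 q2 q3 /asboolP h12 /asboolP h23; apply/asboolP => x.
  exact: le_trans (h23 x) (h12 x).
- move=> [q1 h1] [q2 h2] /asboolP h12 /asboolP h21; apply: eq_exist; apply/funext => x.
  by apply/eqP; rewrite eq_le h12 h21.
- move=> A totA; have [->|/set0P[q0 Aq0]] := eqVneq A set0.
    by exists (exist _ p (conj sp (fun=> lexx _))).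
  pose g x := inf [set sval q x | q in A].
  have g_le (q : T) x : A q -> g x <= sval q x.
    by move=> Aq; apply: ge_inf; [exists (- p (- x)) => _ [q' _ <-] //|exists q].
  have g_ge m x : (forall q : T, A q -> m <= sval q x) -> m <= g x.
    move=> h; apply: lb_le_inf => [|_ [q Aq <-]]; last exact: h.
    by exists (sval q0 x), q0.
  have sg : sublinear g.
    split=> [x y|a x a0].
      rewrite -lerBlDr; apply: (g_ge) => q Aq; rewrite lerBlDr -lerBlDl.
      apply: (g_ge) => q' Aq'; rewrite lerBlDl.
      wlog /asboolP qq' : x y q q' Aq Aq' / le q q'.
        move=> h; have [/h|/h h'] := totA _ _ Aq Aq'; first exact.
        by rewrite addrC [leRHS]addrC; exact: h'.
      apply: le_trans (g_le _ (x + y) Aq') _.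
      by apply: le_trans ((svalP q').1.1 x y) _; rewrite lerD2r.
    rewrite -ler_pdivrMl //; apply: (g_ge) => q Aq; rewrite ler_pdivrMl //.
    exact: le_trans (g_le _ _ Aq) ((svalP q).1.2 _ _ a0).
  have gp x : g x <= p x by apply: le_trans (g_le _ x Aq0) ((svalP q0).2 x).
  by exists (exist _ g (conj sg gp)) => q Aq; apply/asboolP => x; exact: g_le.
exists q; split => // q' sq' q'q.
have q'p x : q' x <= p x by apply: le_trans (q'q x) (qp x).
by have /(congr1 sval) := qmin (exist _ q' (conj sq' q'p)) (asboolT q'q).
Qed.

(** A minimal sublinear functional [q] coincides with all its slides, which gives
    [q x <= q (x + y) - q y]: it is linear.  Starting from the slide of [p] along
    [w] ensures that the value at [w] is not lowered. *)
Lemma hahn_banach p w : sublinear p ->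
  exists phi : E -> R^o, [/\ linear phi, forall x, phi x <= p x & phi w = p w].
Proof.
move=> sp; have [q [sq qp qmin]] := minimal_sublinear (slide_sublinear sp w).
have qD x y : q (x + y) = q x + q y.
  apply/eqP; rewrite eq_le sq.1 /= -lerBrDr.
  rewrite -{1}(qmin _ (slide_sublinear sq y) (slide_le_id sq y)).
  by apply: le_trans (slide_le sq y x ler01) _; rewrite scale1r mul1r.
have qN x : q (- x) = - q x.
  by have := qD x (- x); rewrite subrr sublinear0 //; lra.
exists q; split => [a x y|x|].
- rewrite qD; congr (_ + _); have [a0|a0] := leP 0 a; first exact: sublinearZ.
  have Na0 : 0 <= - a by rewrite oppr_ge0 ltW.
  by have := sublinearZ x sq Na0; rewrite scaleNr qN mulNr => /oppr_inj.
- exact: le_trans (qp x) (slide_le_id sp w x).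
apply/eqP; rewrite eq_le (le_trans (qp w)) ?slide_le_id //=.
by rewrite -lerN2 -qN (le_trans (qp _)) // slide_opp.
Qed.

End HahnBanach.

(** * Existence of continuous functionals *)

Section Functionals.
Context {R : realType} {E : normedModType R}.
Implicit Types (x w : E) (phi : dual E).

Lemma dual_of_bounded (g : E -> R^o) (M : R) : linear g ->
  (forall x, `|g x| <= M * `|x|) -> exists phi : dual E, forall x, phi x = g x.
Proof.
move=> lg gM.
suff gP : g \in @dual_pred R E by exists (Dual gP).
apply/asboolP; split => //.
pose h : {linear E -> R^o} := HB.pack g (GRing.isLinear.Build _ _ _ _ _ lg).
apply: (@bounded_linear_continuous _ _ _ h); apply/linear_boundedP.
near=> r => x; apply: le_trans (gM x) _; rewrite ler_wpM2r //.
near: r; apply: nbhs_pinfty_ge; exact: num_real.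
Unshelve. all: by end_near. Qed.

Lemma seminorm_functional (p : E -> R) w : sublinear p ->
  (forall x, p x <= `|x|) ->
  exists phi, (forall x, phi x <= p x) /\ phi w = p w.
Proof.
move=> sp pn; have [g [lg gp gw]] := hahn_banach w sp.
pose h : {linear E -> R^o} := HB.pack g (GRing.isLinear.Build _ _ _ _ _ lg).
have gN x : g (- x) = - g x by exact: (linearN h).
have [|phi phig] := @dual_of_bounded g 1 lg.
  move=> x; rewrite mul1r ler_norml -lerNl -gN -{1}normrN.
  by rewrite !(le_trans (gp _) (pn _)).
by exists phi; split => [x|]; rewrite phig.
Qed.

Lemma norming_functional w :
  exists phi, phi w = `|w| /\ forall x, `|phi x| <= `|x|.
Proof.
have [||phi [phiE phiw]] := @seminorm_functional (fun x => `|x|) w _ _.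
- by split=> [x y|a x a0]; rewrite ?ler_normD // normrZ gtr0_norm.
- by [].
exists phi; split => // x; rewrite ler_norml phiE -lerNl andbT.
by rewrite -normrN -linearN phiE.
Qed.

Definition comb (u : nat -> E) (l : seq (R * nat)) : E :=
  \sum_(c <- l) c.1 *: u c.2.

(** If [w] is annihilated by all functionals vanishing on [u], it belongs to the
    closed span of [u]: otherwise Hahn-Banach applied to the distance to that span
    gives a functional contradicting the hypothesis. *)
Lemma annihilator_dense (u : nat -> E) w :
  (forall phi, (forall n, phi (u n) = 0) -> phi w = 0) ->
  forall e : R, 0 < e -> exists l, `|w - comb u l| < e.
Proof.
move=> annih e e0.
pose p x := inf [set `|x - comb u l| | l in [set: seq (R * nat)]].
have p_le x l : p x <= `|x - comb u l|.
  by apply: ge_inf; [exists 0 => _ [l' _ <-]; exact: normr_ge0|exists l].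
have p_ge x m : (forall l, m <= `|x - comb u l|) -> m <= p x.
  by move=> h; apply: lb_le_inf => [|_ [l _ <-] //]; exists `|x - comb u [::]|, [::].
have sp : sublinear p.
  split=> [x y|a x a0].
    rewrite -lerBlDr; apply: (p_ge) => l; rewrite lerBlDr -lerBlDl.
    apply: (p_ge) => l'; rewrite lerBlDl; apply: le_trans (p_le _ (l ++ l')) _.
    by rewrite /comb big_cat /= opprD addrACA ler_normD.
  rewrite -ler_pdivrMl //; apply: (p_ge) => l; rewrite ler_pdivrMl //.
  apply: le_trans (p_le _ [seq (a * c.1, c.2) | c <- l]) _.
  rewrite /comb big_map /= -{3}(gtr0_norm a0) -normrZ scalerBr scaler_sumr.
  by under eq_bigr => c _ do rewrite -scalerA.
have [|phi [phip phiw]] := seminorm_functional w sp.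
  by move=> x; apply: le_trans (p_le x [::]) _; rewrite /comb big_nil subr0.
have phiu a n : phi (a *: u n) <= 0.
  apply: le_trans (phip _) (le_trans (p_le _ [:: (a, n)]) _).
  by rewrite /comb big_seq1 subrr normr0.
have {phiu}phiu n : phi (u n) = 0.
  by apply/eqP; rewrite eq_le -oppr_le0 -linearN -scaleN1r phiu -[u n]scale1r phiu.
have /(inf_adherent e0) : has_inf [set `|w - comb u l| | l in [set: seq (R * nat)]].
  split; first by exists `|w - comb u [::]|, [::].
  by exists 0 => _ [l' _ <-]; exact: normr_ge0.
by move=> [_ [l _ <-]]; rewrite -/(p w) -phiw annih // add0r; exists l.
Qed.

Definition ratcomb (u : nat -> E) (l : seq (rat * nat)) : E :=
  \sum_(c <- l) ratr c.1 *: u c.2.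

Lemma ratcomb_dense (u : nat -> E) l (e : R) : 0 < e ->
  exists l', `|comb u l - ratcomb u l'| < e.
Proof.
elim: l e => [|[a n] l IH] e e0.
  by exists [::]; rewrite /comb /ratcomb !big_nil subrr normr0.
have e2 : 0 < e / 2 by rewrite divr_gt0.
have [l' hl'] := IH _ e2.
have un : 0 < 1 + `|u n| by rewrite ltr_wpDr.
have [q] : exists q : rat, ratr q \in `]a, (a + e / 2 / (1 + `|u n|))[.
  by apply: rat_in_itvoo; rewrite ltrDl divr_gt0.
rewrite in_itv /= => /andP[aq qa].
exists ((q, n) :: l'); rewrite /comb /ratcomb !big_cons /= opprD addrACA -scalerBl.
apply: le_lt_trans (ler_normD _ _) _; rewrite [ltRHS]splitr ler_ltD //.
rewrite normrZ distrC gtr0_norm ?subr_gt0 //.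
apply: (@le_trans _ _ ((ratr q - a) * (1 + `|u n|))).
  by rewrite ler_wpM2l ?subr_ge0 ?lerDr // ltW.
by rewrite -ler_pdivlMr // lerBlDl ltW.
Qed.

End Functionals.

(** * Ultrafilters and weak sequential compactness *)

Section Ultralimits.

Lemma ultra_fmap (T U : Type) (F : set_system T) (f : T -> U) :
  UltraFilter F -> UltraFilter (f x @[x --> F]).
Proof.
move=> FU; split=> [|G GP FG]; first exact: fmap_proper_filter.
rewrite eqEsubset; split=> // A GA.
have [//|FnA] := in_ultra_setVsetC (f @^-1` A) FU.
have /FG GnA : (f x @[x --> F]) (~` A) by [].
by have [x []] := filter_ex (filterI GA GnA).
Qed.

Lemma ultra_compact (T : Type) (X : topologicalType) (F : set_system T)
    (f : T -> X) (K : set X) : UltraFilter F -> compact K ->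
  (forall t, K (f t)) -> exists2 l, K l & f x @[x --> F] --> l.
Proof.
move=> FU cK fK; have := ultra_fmap f FU; move: cK; rewrite compact_ultra => cK UF.
have [|l [Kl fl]] := cK _ UF; last by exists l.
by suff : F (f @^-1` K) by []; apply: filterS filterT => t _; exact: fK.
Qed.

(** The ultralimits of [phi (u t)] exist by compactness of bounded intervals; as a
    function of [phi] they form an element of the bidual, which reflexivity
    represents by a vector. *)
Lemma weak_ultralimit (R : realType) (E : normedModType R) (T : Type)
    (F : set_system T) (u : T -> E) (M : R) :
  reflexive_space E -> UltraFilter F -> (forall t, `|u t| <= M) ->
  exists z : E, forall phi : dual E, phi (u t) @[t --> F] --> phi z.
Proof.
move=> reflE FU uM.
have phiuM (phi : dual E) t : `|phi (u t)| <= M * `|phi|.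
  apply: le_trans (dual_normP phi (u t)) _; rewrite mulrC.
  by rewrite ler_wpM2r //; exact: (normr_ge0 phi).
have /choice[L phiL] (phi : dual E) :
    exists l : R^o, `|l| <= M * `|phi| /\ phi (u t) @[t --> F] --> l.
  have [|l] := @ultra_compact T R^o F (fun t => phi (u t)) _ FU
    (@segment_compact R (- (M * `|phi|)) (M * `|phi|)).
    by move=> t /=; rewrite in_itv /= -ler_norml.
  by rewrite /= in_itv /= -ler_norml; exists l.
have lL : linear (L : dual E -> R^o).
  move=> a phi psi; apply: (@cvg_unique R^o _ _ _ _ _ (phiL (a *: phi + psi)).2) => //.
  by apply: cvgD; [apply: cvgZl_tmp|]; exact: (phiL _).2.
have [Phi PhiL] := dual_of_bounded lL (fun phi => (phiL phi).1).
have [z zPhi] := reflE Phi; exists z => phi.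
by have := (phiL phi).2; rewrite -PhiL -zPhi.
Qed.

End Ultralimits.

(** Were some neighbourhood of [l] not reached, an ultrafilter containing the
    complement of its preimage would contradict convergence. *)
Lemma cvg_ultra (T : Type) (X : topologicalType) (F : set_system T) (f : T -> X) (l : X) :
  Filter F ->
  (forall V : set_system T, UltraFilter V -> F `<=` V -> f x @[x --> V] --> l) ->
  f x @[x --> F] --> l.
Proof.
move=> FF h B lB; apply: contrapT => nFB.
pose G := within (~` (f @^-1` B)) F.
have GP : ProperFilter G.
  apply: Build_ProperFilter_ex.
  move=> P GP; apply: contrapT => nP; apply: nFB.
  suff : F (f @^-1` B) by [].
  apply: (@filterS _ F _ _ _ _ GP) => x Px; apply: contrapT => nBx; apply: nP.
  by exists x; exact: Px.
have [V [VU GV]] := ultraFilterLemma GP.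
have FV : F `<=` V by apply: subset_trans GV => A FA; apply: filterS FA => x Ax _.
have VB : V (f @^-1` B) by exact: h V VU FV B lB.
have VnB : V (~` (f @^-1` B)) by apply: GV; exact: withinT.
by have [x []] := filter_ex (filterI VB VnB).
Qed.

Section WeakSequentialCompactness.
Context {R : realType} {E : normedModType R}.
Hypothesis reflE : reflexive_space E.

Lemma inv_succ_cvg0 : (k.+1%:R^-1 : R) @[k --> \oo] --> (0 : R).
Proof.
apply/cvgrPdist_lt => e e0; near=> k.
rewrite sub0r normrN gtr0_norm ?invr_gt0 // invf_plt ?posrE // .
apply: (@lt_le_trans _ _ k%:R); last by rewrite ler_nat.
near: k; exact: nbhs_infty_gtr.
Unshelve. all: by end_near. Qed.

(** This is the Eberlein-Smulian argument.  Let [z] be a weak ultralimit of [u].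
    Rational combinations of [u] are countably many, so are functionals [psi l]
    norming each of them, and one can choose a subsequence along which every
    [psi l] converges to [psi l z].  Any weak ultralimit [z'] of that subsequence
    then has the same images as [z] under all [psi l]; since [z - z'] lies in the
    closed span of [u], where the [psi l] determine the norm, it is zero. *)
Theorem weak_sequential_compactness (u : nat -> E) (M : R) :
  (forall n, `|u n| <= M) ->
  exists z (s : nat -> nat), (forall k, (k <= s k)%N) /\ weak_cvg (u \o s) z.
Proof.
move=> uM.
have [U [UU ooU]] := ultraFilterLemma (eventually_filter : ProperFilter \oo).
have [z zU] := weak_ultralimit reflE UU uM.
have /choice[psi psiP] := fun l => norming_functional (ratcomb u l).
pose psi' j := psi (odflt [::] (unpickle j)).
have /choice[s sP] k : exists n, (k <= n)%N /\
    forall j : 'I_k.+1, `|psi' j z - psi' j (u n)| < k.+1%:R^-1.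
  apply: (@filter_ex _ U); apply: filterI; first exact/ooU/nbhs_infty_ge.
  apply: filter_forall => j.
  by apply: (cvgr_dist_lt _ _ (zU (psi' j))); rewrite invr_gt0.
exists z, s; split=> [k|phi]; first by have [] := sP k.
have psi_cvg l : psi l (u (s k)) @[k --> \oo] --> psi l z.
  have <- : psi' (pickle l) = psi l by rewrite /psi' pickleK.
  apply/cvgrPdist_lt => e e0; near=> k.
  have jk : (pickle l < k.+1)%N by rewrite ltnS; near: k; exact: nbhs_infty_ge.
  apply: lt_trans ((sP k).2 (Ordinal jk)) _.
  near: k; apply: (filterS _ (cvgr_dist_lt _ _ inv_succ_cvg0 e e0)) => k.
  by rewrite sub0r normrN gtr0_norm ?invr_gt0.
apply: cvg_ultra => V VU ooV.
have [z' z'V] := weak_ultralimit (u := u \o s) reflE VU (fun k => uM (s k)).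
suff -> : z = z' by exact: z'V.
have psiE l : psi l z' = psi l z.
  apply: (@cvg_unique R^o _ _ _ _ _ (z'V (psi l))) => //.
  by apply: cvg_trans (psi_cvg l); apply: cvg_fmap2.
have annih (chi : dual E) : (forall n, chi (u n) = 0) -> chi (z - z') = 0.
  move=> chiu; rewrite linearB /=.
  have -> : chi z = 0.
    apply: (@cvg_unique R^o _ _ _ _ _ (zU chi)) => //.
    by apply: cvg_near_cst; apply: nearW => n; exact: chiu.
  have -> : chi z' = 0; last by rewrite subrr.
  apply: (@cvg_unique R^o _ _ _ _ _ (z'V chi)) => //.
  by apply: cvg_near_cst; apply: nearW => n; exact: chiu.
apply/eqP; rewrite -subr_eq0 -normr_le0; apply/ler_addgt0Pl => e e0; rewrite addr0.
have e4 : 0 < e / 4 by rewrite divr_gt0.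
have [l hl] := annihilator_dense annih e4.
have [l' hl'] := ratcomb_dense u l e4.
set c := ratcomb u l' in hl'.
have dist : `|z - z' - c| < e / 2.
  rewrite -(subrK (comb u l) (z - z')) -addrA.
  have := ler_normD (z - z' - comb u l) (comb u l - c); lra.
have cE : `|c| <= `|z - z' - c|.
  have [psic psin] := psiP l'; rewrite -/c in psic.
  apply: le_trans (psin _); suff -> : psi l' (z - z' - c) = - psi l' c.
    by rewrite normrN psic normr_id.
  by rewrite 2!linearB /= psiE subrr sub0r.
have := ler_normD (z - z' - c) c; rewrite subrK; lra.
Unshelve. all: by end_near. Qed.

End WeakSequentialCompactness.

(** * A retraction of the whole space onto its unit sphere *)

Section Triangular.
Context {R : realType} {E : normedModType R}.
Hypothesis E_infinite : infinite_dimensional E.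

(** The common kernel of finitely many functionals has finite codimension, as each
    functional costs at most one dimension. *)
Lemma common_kernel_cofinite (L : seq (dual E)) :
  exists s : seq E, forall x : E, exists c : nat -> R,
    forall phi, phi \in L -> phi (x - \sum_(i < size s) c i *: s`_i) = 0.
Proof.
elim: L => [|psi L [s sP]]; first by exists [::] => x; exists (fun=> 0).
have [[y [yL psiy]]|noy] :=
  pselect (exists y : E, (forall phi, phi \in L -> phi y = 0) /\ psi y != 0).
  exists (y :: s) => x; have [c cP] := sP x.
  set x' := x - _ in cP.
  exists (fun n => if n is n'.+1 then c n' else psi x' / psi y) => phi.
  rewrite inE /= big_ord_recl /= opprD [- _ + _]addrC addrA -/x' linearB linearZ /=.
  rewrite /GRing.scale /= => /predU1P[->|phiL]; last by rewrite (cP phi) // (yL phi) // mulr0 subrr.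
  by rewrite mulfVK // subrr.
exists s => x; have [c cP] := sP x; exists c => phi.
move=> /predU1P[->|]; last exact: cP.
by apply/eqP; apply: contrapT => /negP h; apply: noy; exists (x - \sum_(i < size s) c i *: s`_i).
Qed.

Lemma common_kernel_unit (L : seq (dual E)) :
  exists v : E, `|v| = 1 /\ forall phi, phi \in L -> phi v = 0.
Proof.
have [s sP] := common_kernel_cofinite L.
have [[v [v0 vL]]|nov] :=
  pselect (exists v : E, v != 0 /\ forall phi, phi \in L -> phi v = 0).
  exists (`|v|^-1 *: v); split; first exact: normfZV.
  by move=> phi phiL; rewrite linearZ /= vL // scaler0.
exfalso; apply: E_infinite; exists s => x; have [c cP] := sP x.
exists (fun i => c i); apply/eqP; rewrite -subr_eq0.
by apply: contrapT => /negP h; apply: nov; eexists; split; first exact: h.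
Qed.

(** Each [v n] is taken in the common kernel of the previous functionals, and
    [psi n] norming at [v n].  Thus [psi k] vanishes on all later vectors, and will
    separate them from combinations involving [v k]. *)
Lemma triangular_system : exists (v : nat -> E) (psi : nat -> dual E),
  [/\ forall n, `|v n| = 1, forall n, psi n (v n) = 1,
      forall n x, `|psi n x| <= `|x| & forall k n, (k < n)%N -> psi k (v n) = 0].
Proof.
have /choice[step stepP] (L : seq (dual E)) : exists vphi : E * dual E,
    [/\ `|vphi.1| = 1, forall phi, phi \in L -> phi vphi.1 = 0,
        vphi.2 vphi.1 = 1 & forall x, `|vphi.2 x| <= `|x|].
  have [v [v1 vL]] := common_kernel_unit L.
  have [phi [phiv phin]] := norming_functional v.
  by exists (v, phi); split => //=; rewrite phiv.
pose L n := iter n (fun L => (step L).2 :: L) [::].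
exists (fun n => (step (L n)).1), (fun n => (step (L n)).2).
split => [n|n|n|k n kn]; try by have [] := stepP (L n).
have [_ vL _ _] := stepP (L n); apply: vL.
elim: n kn => // n IH; rewrite ltnS leq_eqVlt => /predU1P[->|/IH h].
  exact: mem_head.
by rewrite /= inE h orbT.
Qed.

End Triangular.

Section Path.
Context {R : realType} {E : normedModType R}.

Definition hat (u : R) : R := Num.max 0 (1 - `|u|).

Lemma hat_continuous : continuous hat.
Proof.
move=> u; apply: (@continuous_max R R (fun=> 0) (fun u => 1 - `|u|) u); first exact: cvg_cst.
by apply: cvgB; [exact: cvg_cst|exact: norm_continuous].
Qed.

Variable w : nat -> E.

Definition polygon_upto N (s : R) : E := \sum_(m < N) hat (s - m%:R) *: w m.

(** The polygonal path with vertex [w n] at time [n].  The sum of tent functions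
    makes it continuous at once; the terms after [Num.truncn s + 1] vanish at [s], so
    the bound of the sum only has to be large enough. *)
Definition polygon (s : R) : E := polygon_upto (Num.truncn s).+2 s.

Lemma polygon_upto_continuous N : continuous (polygon_upto N).
Proof.
elim: N => [|N IH] s.
  have -> : polygon_upto 0 = fun=> 0 by apply/funext => t; exact: big_ord0.
  exact: cvg_cst.
have -> : polygon_upto N.+1 = fun t => polygon_upto N t + hat (t - N%:R) *: w N.
  by apply/funext => t; exact: big_ord_recr.
apply: cvgD; first exact: IH.
apply: cvgZr_tmp; apply: (continuous_cvg _ (@hat_continuous (s - N%:R))).
by apply: cvgB; [exact: cvg_id|exact: cvg_cst].
Qed.

Lemma polygon_upto_stable M N (s : R) : (M <= N)%N -> s + 1 <= M%:R ->
  polygon_upto N s = polygon_upto M s.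
Proof.
move=> MN sM; rewrite -(subnKC MN); elim: (N - M)%N => [|d IH]; first by rewrite addn0.
rewrite addnS /polygon_upto big_ord_recr /= [X in _ + X](_ : _ = 0) ?addr0 //.
rewrite /hat max_l ?scale0r //.
have : (M%:R : R) <= (M + d)%:R by rewrite ler_nat leq_addr.
have := ler_norm (- (s - (M + d)%:R)); rewrite normrN; lra.
Qed.

Lemma polygonE N (s : R) : s + 1 <= N%:R -> polygon s = polygon_upto N s.
Proof.
move=> sN; have sT : s + 1 <= (Num.truncn s).+2%:R.
  by rewrite -natr1 lerD2r ltW // truncnS_gt.
rewrite /polygon; have [TN|NT] := leqP (Num.truncn s).+2 N.
  by rewrite (polygon_upto_stable TN).
by rewrite (polygon_upto_stable (ltnW NT)).
Qed.

Lemma polygon_continuous : continuous polygon.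
Proof.
move=> s; pose N := (Num.truncn (s + 2)).+1.
have sN : s + 2 < N%:R by exact: truncnS_gt.
have near_eq : {near s, polygon_upto N =1 polygon}.
  near=> t; rewrite (@polygonE N) //.
  have : t < s + 1 by near: t; apply: lt_nbhsl; rewrite ltrDl ltr01.
  lra.
rewrite /continuous_at (@polygonE N); last by lra.
by apply: cvg_trans (near_eq_cvg near_eq) _; exact: polygon_upto_continuous.
Unshelve. all: by end_near. Qed.

Lemma polygon_segment n (s : R) : n%:R <= s <= n.+1%:R ->
  polygon s = (n.+1%:R - s) *: w n + (s - n%:R) *: w n.+1.
Proof.
move=> /andP[ns sn]; rewrite (@polygonE n.+2); last by rewrite -natr1 lerD2r.
rewrite -natr1 in sn *.
rewrite /polygon_upto !big_ord_recr /= big1 ?add0r => [|[i /= iN] _].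
  congr (_ *: _ + _ *: _); rewrite /hat.
    by rewrite ger0_norm ?subr_ge0 // max_r; lra.
  by rewrite -natr1 ler0_norm ?subr_le0 // max_r; lra.
rewrite /hat max_l ?scale0r //.
have : (i.+1%:R : R) <= n%:R by rewrite ler_nat.
rewrite -natr1; have := ler_norm (s - i%:R); lra.
Qed.

End Path.

Section Retraction.
Context {R : realType} {E : normedModType R}.
Hypothesis E_infinite : infinite_dimensional E.

(** On a polygon through vertices proportional to the [v n], a point of the
    segment number [n + 1] is separated by [psi n] or by [psi n.+1] from all the
    segments that are at least two steps further. *)
Lemma escaping_path : exists gam : R -> E,
  [/\ continuous gam, gam 0 = 0, forall s, 0 <= s -> `|gam s| <= 2^-1 &
      forall s t, 1 <= s -> s + 2 <= t -> 6^-1 <= `|gam s - gam t| ].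
Proof.
have [v [psi [v1 psiv psin psi0]]] := triangular_system E_infinite.
pose w n := if n is n'.+1 then 2^-1 *: v n' else 0.
have wn n : `|w n| <= 2^-1.
  case: n => [|n] /=; first by rewrite normr0 invr_ge0.
  by rewrite normrZ v1 mulr1 gtr0_norm ?invr_gt0.
have psiw k n : psi k (w n.+1) = 2^-1 * psi k (v n) by rewrite linearZ.
have truncP (s : R) : 0 <= s -> (Num.truncn s)%:R <= s <= (Num.truncn s).+1%:R.
  by move=> /truncn_itv/andP[-> /ltW].
exists (polygon w); split.
- exact: polygon_continuous.
- by rewrite (@polygon_segment _ _ _ 0) ?lexx ?ler01 // subrr scale0r scaler0 addr0.
- move=> s /truncP sn; rewrite (polygon_segment _ sn).
  set n := Num.truncn s in sn *; rewrite -natr1 in sn *.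
  have a0 : 0 <= n%:R + 1 - s by lra.
  have b0 : 0 <= s - n%:R by lra.
  apply: le_trans (ler_normD _ _) _.
  rewrite [X in X + _]normrZ [X in _ + X]normrZ (ger0_norm a0) (ger0_norm b0).
  have : (n%:R + 1 - s) * `|w n| <= (n%:R + 1 - s) * 2^-1 by apply: ler_wpM2l; [lra|].
  have : (s - n%:R) * `|w n.+1| <= (s - n%:R) * 2^-1 by apply: ler_wpM2l; [lra|].
  lra.
move=> s t s1 st; have s0 : 0 <= s by lra.
have t0 : 0 <= t by lra.
case nE : (Num.truncn s) => [|n].
  by move: s1; rewrite -truncn_gt0 nE.
have := truncP s s0; rewrite nE => sn; have := truncP t t0 => tm.
have : (n.+3 <= Num.truncn t)%N.
  rewrite truncn_ge_nat //; apply: le_trans st.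
  by have /andP[+ _] := sn; rewrite -[n.+3]addn2 natrD lerD2r.
case mE : (Num.truncn t) tm => [//|m] tm; rewrite ltnS => nm.
have psit k : (k <= n.+1)%N -> psi k (polygon w t) = 0.
  move=> kn; rewrite (polygon_segment _ tm) linearD !linearZ /= !psi0 ?scaler0 ?addr0 //; lia.
have psis k : psi k (polygon w s) =
    2^-1 * ((n.+2%:R - s) * psi k (v n) + (s - n.+1%:R) * psi k (v n.+1)).
  rewrite (polygon_segment _ sn) linearD !linearZ /= /GRing.scale /=; ring.
have ge k : (k <= n.+1)%N -> psi k (polygon w s) <= `|polygon w s - polygon w t|.
  move=> kn; apply: le_trans (psin k _); rewrite linearB /= psit // subr0; exact: ler_norm.
(* With [s = n + 1 + a], these functionals give the bounds [(1 - a) / 2] and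
   [a - 1 / 2], one of which is at least [1 / 6]. *)
have := ge n (leqnSn n); have := ge n.+1 (leqnn _).
rewrite !psis !psiv (psi0 n n.+1) // mulr0 addr0.
have := psin n.+1 (v n); rewrite v1 ler_norml => /andP[h _].
rewrite -(natr1 n.+1) in sn *.
set a := s - n.+1%:R; have -> : n.+1%:R + 1 - s = 1 - a by rewrite /a; ring.
have a01 : 0 <= a <= 1 by rewrite /a; lra.
move: (psi n.+1 (v n)) h => y hy; move: (`|_|) => d.
have : (1 - a) * -1 <= (1 - a) * y by apply: ler_wpM2l; lra.
lra.
Qed.

Section Ray.
Variable gam : R -> E.

(** Small on the far part of the path: at most [(1 + s)^-1] at [gam s]. *)
Definition ray_gauge (x : E) : R :=
  inf [set `|x - gam s| + (1 + s)^-1 | s in [set s | 0 <= s]].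

Lemma ray_gauge_le x s : 0 <= s -> ray_gauge x <= `|x - gam s| + (1 + s)^-1.
Proof.
move=> s0; apply: ge_inf; last by exists s.
by exists 0 => _ [t /= t0 <-]; rewrite addr_ge0 // invr_ge0 addr_ge0.
Qed.

Lemma ray_gauge_ge x m : (forall s, 0 <= s -> m <= `|x - gam s| + (1 + s)^-1) ->
  m <= ray_gauge x.
Proof.
move=> h; apply: lb_le_inf => [|_ [s s0 <-]]; last exact: h.
by exists (`|x - gam 0| + (1 + 0)^-1), 0 => /=.
Qed.

Lemma ray_gauge_continuous : continuous ray_gauge.
Proof.
have lip x y : ray_gauge x <= ray_gauge y + `|x - y|.
  rewrite -lerBlDr; apply: ray_gauge_ge => s s0; rewrite lerBlDr.
  apply: le_trans (ray_gauge_le x s0) _; rewrite addrAC lerD2r addrC.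
  by rewrite -(subrKA y) ler_normD.
move=> x; apply/cvgrPdist_le => e e0; near=> y.
have : `|x - y| <= e by near: y; apply: cvgr_dist_le.
rewrite ler_norml; have := lip x y; have := lip y x; rewrite (distrC y x); lra.
Unshelve. all: by end_near. Qed.

(** At most a short piece of the path comes close to [x]. *)
Lemma ray_gauge_gt0 x :
  (forall s t, 1 <= s -> s + 2 <= t -> 6^-1 <= `|gam s - gam t|) -> 0 < ray_gauge x.
Proof.
move=> gap.
(* Two points of the path at distance less than half the gap from [x] have
   parameters differing by less than 2. *)
have [N [N0 far]] : exists N : R, 0 <= N /\ forall t, N <= t -> 12^-1 <= `|x - gam t|.
  have [[s [s1 sx]]|nos] := pselect (exists s, 1 <= s /\ `|x - gam s| < 12^-1).
    exists (s + 2); split; first by lra.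
    move=> t st; have := gap _ _ s1 st.
    have := ler_normD (gam s - x) (x - gam t); rewrite subrKA (distrC (gam s) x); lra.
  exists 1; split => // t t1; rewrite leNgt; apply/negP => h.
  by apply: nos; exists t.
apply: (@lt_le_trans _ _ (Num.min 12^-1 (1 + N)^-1)).
  by rewrite lt_min !invr_gt0 ltr0n /=; lra.
apply: ray_gauge_ge => s s0; rewrite ge_min; have [Ns|sN] := leP N s.
  by rewrite (le_trans (far _ Ns)) // lerDl invr_ge0; lra.
apply/orP; right; apply: (@le_trans _ _ (1 + s)^-1); last by rewrite lerDr.
by rewrite lef_pV2 ?posrE; lra.
Qed.

End Ray.

(** The map [q x = x - gam (tau x)] never vanishes: if [x = gam (tau x)], then the
    gauge of [x] is at most [(1 + tau x)^-1], whereas inside the half ball, where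
    the path lives, [tau x] is at least the inverse of the gauge.  Outside the unit
    ball [tau] is zero, so that [q] is the identity there, and normalizing [q] gives
    the retraction. *)
Theorem sphere_retraction : exists r : E -> E,
  [/\ continuous r, forall x, `|r x| = 1 & forall x, `|x| = 1 -> r x = x].
Proof.
have [gam [gam_c gam0 gam_le gam_gap]] := escaping_path.
pose be := ray_gauge gam.
have be_gt0 x : 0 < be x by exact: ray_gauge_gt0.
pose tau x : R := Num.max 0 (2 - 2 * `|x|) / be x.
have tau_c : continuous tau.
  move=> x; apply: cvgM.
    apply: (@continuous_max R E (fun=> 0) (fun x => 2 - 2 * `|x|) x); first exact: cvg_cst.
    apply: cvgB; first exact: cvg_cst.
    by apply: cvgMl_tmp; exact: norm_continuous.
  apply: cvgV; first by rewrite gt_eqF.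
  exact: ray_gauge_continuous.
have tau_ge0 x : 0 <= tau x by rewrite divr_ge0 ?le_max ?lexx // ltW.
(* [gam 0 = 0], so [q] fixes the points where [tau] is zero. *)
pose q x := x - gam (tau x).
have q0 x : q x != 0.
  apply/negP; rewrite subr_eq0 => /eqP xE.
  have xn : `|x| <= 2^-1 by rewrite xE gam_le.
  have tau1 : (be x)^-1 <= tau x.
    rewrite /tau -[leLHS]mul1r ler_pM2r ?invr_gt0 // le_max; apply/orP; right; lra.
  have := ray_gauge_le gam x (tau_ge0 x); rewrite -xE subrr normr0 add0r -/be => bex.
  have : (1 + tau x) <= (be x)^-1.
    by rewrite -[leLHS]invrK lef_pV2 ?posrE ?invr_gt0 //; have := tau_ge0 x; lra.
  lra.
exists (fun x => `|q x|^-1 *: q x); split.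
- move=> x; have qc : q y @[y --> x] --> q x.
    apply: cvgB; first exact: cvg_id.
    by apply: (continuous_cvg _ (@gam_c (tau x))); exact: tau_c.
  by apply: cvgZ => //; apply: cvgV; [rewrite normr_eq0|exact: cvg_norm].
- by move=> x; rewrite normfZV.
move=> x x1; have tau0 : tau x = 0 by rewrite /tau x1 mulr1 subrr maxxx mul0r.
by rewrite /q tau0 gam0 subr0 x1 invr1 scale1r.
Qed.

End Retraction.

(** * A variational inequality on a finite-dimensional simplex *)

Section Variational.
Context {R : realType} {E : normedModType R} (I : finType).
Variables (i0 : I) (x : I -> E) (G : E -> dual E).
Hypothesis G_c : continuous G.

Let bary (q : I -> R) : E := \sum_i q i *: x i.
Let freq N (t : grid I N.+1) (i : I) : R := (val t i)%:R / N.+1%:R.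

Lemma bary_cvg (T : Type) (F : set_system T) (q : T -> I -> R) (p : I -> R) :
  Filter F -> (forall i, q t i @[t --> F] --> p i) ->
  bary (q t) @[t --> F] --> bary p.
Proof.
move=> FF qp; apply: cvg_big => [|i _]; first exact: add_continuous.
exact: cvgZr_tmp.
Qed.

Lemma eval_cvg (T : Type) (F : set_system T) (u : T -> E) (z y : E) :
  Filter F -> u t @[t --> F] --> z -> G (u t) y @[t --> F] --> G z y.
Proof.
move=> FF uz; apply: (continuous_cvg _ (@dual_continuous _ _ (bidual_eval y) (G z))).
by apply: (continuous_cvg _ (@G_c z)).
Qed.

Lemma freq_bounds N (t : grid I N.+1) i : 0 <= freq t i <= 1.
Proof.
rewrite divr_ge0 //= ler_pdivrMr // mul1r ler_nat -ltnS; exact: ltn_ord.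
Qed.

Lemma freq_sum N (t : grid I N.+1) : \sum_i freq t i = 1.
Proof.
by rewrite -mulr_suml -natr_sum (eqP (valP t)) divff ?pnatr_eq0.
Qed.

(** Colour a point of the simplex by an index [i] maximizing [G z (x i)].  In the
    limit of finer and finer grids, near-rainbow points converge to a point [p] at
    which, for every [k], either the weight [p k] is zero or [k] maximizes
    [G z (x k)]; the average of these values under [p] is then their maximum. *)
Theorem finite_variational_inequality : exists p : I -> R,
  [/\ forall i, 0 <= p i, \sum_i p i = 1 &
      forall j, G (bary p) (x j) <= G (bary p) (bary p)].
Proof.
pose best z := [arg max_(j > i0) G z (x j)]%O.
have bestP z j : G z (x j) <= G z (x (best z)).
  by rewrite /best; case: arg_maxP => // i _; apply.
pose color N (t : grid I N.+1) := best (bary (freq t)).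
have ext N := cid (rainbow_near_point i0 (@color N)).
pose t N := projT1 (ext N); have tP N := projT2 (ext N); rewrite -/(t _) in tP.
have [U [UU ooU]] := ultraFilterLemma (eventually_filter : ProperFilter \oo).
have small : (#|I|%:R / N.+1%:R : R) @[N --> U] --> (0 : R).
  apply: (@cvg_trans _ ((#|I|%:R / N.+1%:R : R) @[N --> \oo])); first exact: cvg_fmap2.
  suff : (#|I|%:R / N.+1%:R : R) @[N --> \oo] --> (#|I|%:R * 0 : R) by rewrite mulr0.
  by apply: cvgMl_tmp; exact: inv_succ_cvg0.
have /choice[p pP] i : exists l : R, 0 <= l <= 1 /\ freq (t N) i @[N --> U] --> l.
  have [|l] := @ultra_compact nat R U (fun N => freq (t N) i) _ UU (@segment_compact R 0 1).
    by move=> N /=; rewrite in_itv /= freq_bounds.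
  by rewrite /= in_itv /=; exists l.
have p1 : \sum_i p i = 1.
  apply: (@cvg_unique R^o _ (\sum_i freq (t N) i @[N --> U])).
  - exact: norm_hausdorff.
  - apply: cvg_big => [|i _]; first exact: (@add_continuous R^o).
    exact: (pP i).2.
  - by apply: cvg_near_cst; apply: nearW => N; exact: freq_sum.
exists p; split => // [i|j]; first by have [/andP[]] := pP i.
set z := bary p.
have maxi k : p k = 0 \/ G z (x j) <= G z (x k).
  have [Usmall|Ubig] := in_ultra_setVsetC [set N | (val (t N) k < #|I|)%N] UU.
    left; apply/eqP; rewrite eq_le (andP (pP k).1).1 andbT.
    apply: (ler_cvg_to (pP k).2 small); apply: filterS Usmall => N /= tk.
    by rewrite ler_pM2r ?invr_gt0 // ler_nat ltnW.
  right.
  have exy N : exists y : grid I N.+1, ~ (val (t N) k < #|I|)%N ->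
      color N y = k /\ forall i, `|freq y i - freq (t N) i| <= #|I|%:R / N.+1%:R.
    have [tk|[y cy yt]] := tP N k; first by exists (t N).
    exists y => _; split=> // i; have [yti tyi] := yt i.
    rewrite -mulrBl normrM [X in _ * X]gtr0_norm ?invr_gt0 // ler_pM2r ?invr_gt0 //.
    have : ((val y i)%:R : R) <= (val (t N) i + #|I|)%:R by rewrite ler_nat ltnW.
    have : ((val (t N) i)%:R : R) <= (val y i + #|I|)%:R by rewrite ler_nat ltnW.
    rewrite !natrD ler_norml; lra.
  pose y N := projT1 (cid (exy N)); have yP N := projT2 (cid (exy N)).
  have yp i : freq (y N) i @[N --> U] --> p i.
    have d0 : freq (y N) i - freq (t N) i @[N --> U] --> (0 : R).
      apply/cvgrPdist_le => e e0; near=> N; rewrite sub0r normrN.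
      have Nk : ~ (val (t N) k < #|I|)%N by near: N; exact: Ubig.
      apply: le_trans ((yP N Nk).2 i) _.
      apply: le_trans (ler_norm _) _; rewrite -normrN -sub0r.
      by near: N; move/cvgrPdist_le: small; apply.
    have -> : (fun N => freq (y N) i) =
        (fun N => (freq (y N) i - freq (t N) i) + freq (t N) i).
      by apply/funext => N; rewrite subrK.
    by rewrite -[p i]add0r; exact: cvgD d0 (pP i).2.
  have Gy i : G (bary (freq (y N))) (x i) @[N --> U] --> G z (x i).
    by apply: eval_cvg; exact: bary_cvg.
  apply: (@ler_cvg_to nat U _ R _ _ _ _ (Gy j) (Gy k)).
  by apply: filterS Ubig => N Nk; rewrite -[in leRHS](yP N Nk).1.
rewrite -[leLHS]mul1r -p1 mulr_suml {2}/z linear_sum /=.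
apply: ler_sum => i _; rewrite linearZ /=.
have [->|le] := maxi i; first by rewrite mul0r scale0r.
by apply: ler_wpM2l => //; have [/andP[]] := pP i.
Unshelve. all: by end_near. Qed.

End Variational.

(** * Vectors almost norming a compact function, and the limit *)

Section Main.
Context {R : realType} {E : normedModType R}.

Lemma eval_continuous (x : E) : continuous (fun phi : dual E => phi x).
Proof. by have := @dual_continuous _ _ (bidual_eval x). Qed.

Lemma deficit_continuous (x : E) : continuous (fun phi : dual E => phi x - `|phi| : R).
Proof.
move=> phi.
exact: (@cvgB R R^o (dual E) (nbhs phi) _ _ _ _ _ (@eval_continuous x phi)
  (@norm_continuous R (dual E) phi)).
Qed.

Lemma dual_norm_almost_attained (phi : dual E) (e : R) : 0 < e ->
  exists x : E, `|x| <= 1 /\ `|phi| - e < phi x.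
Proof.
move=> e0; have [_ [x /= x1 <-]] := sup_adherent e0 (dual_has_sup phi).
rewrite -dual_normE => h; have [p0|p0] := leP 0 (phi x).
  by exists x; rewrite -[phi x]ger0_norm.
by exists (- x); rewrite normrN linearN /= -[- phi x]ltr0_norm.
Qed.

(** The property extends from the sphere to sequences with norms tending to 1 by
    normalizing them; [z] stands in for the undefined normalization of 0. *)
Lemma Kadec_Klee_cvg (u : nat -> E) (z : E) : Kadec_Klee E -> `|z| = 1 ->
  `|u n| @[n --> \oo] --> (1 : R) -> weak_cvg u z -> u n @[n --> \oo] --> z.
Proof.
move=> KK z1 un uz.
pose y n := if u n == 0 then z else `|u n|^-1 *: u n.
have y1 n : sphere E (y n).
  by rewrite /sphere /y /=; case: eqVneq => // u0; rewrite normfZV.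
have u_neq0 : \forall n \near \oo, u n != 0.
  by apply: (filterS _ (cvgr_gt _ un 0 ltr01)) => n; rewrite normr_gt0.
pose ys n : sphere E := SigSub (mem_set (y1 n)).
pose zs : sphere E := SigSub (mem_set (z1 : sphere E z)).
have /norm_cvg0P : `|\val (ys n) - \val zs| @[n --> \oo] --> (0 : R).
  apply: KK => phi.
  have : `|u n|^-1 * phi (u n) @[n --> \oo] --> (1^-1 * phi z : R).
    by apply: cvgM; [apply: cvgV => //; exact: oner_neq0|exact: uz].
  rewrite invr1 mul1r; apply: cvg_trans; apply: near_eq_cvg.
  apply: filterS u_neq0 => n un0 /=; rewrite /y (negPf un0).
  by rewrite linearZ.
move=> /(cvgD (cvg_cst z)); rewrite addr0.
move=> /(cvgZ un); rewrite scale1r; apply: cvg_trans; apply: near_eq_cvg.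
apply: filterS u_neq0 => n un0 /=; rewrite addrC subrK /y (negPf un0).
by rewrite scalerA divff ?normr_eq0 // scale1r.
Qed.

(** The open sets of functionals normed up to [e] by a given vector of the unit
    ball cover the dual, hence finitely many cover the range of [G]; the variational inequality is
    applied to the corresponding vectors. *)
Lemma almost_norming (G : E -> dual E) (e : R) : continuous G ->
  precompact (range G) -> 0 < e ->
  exists z, `|z| <= 1 /\ `|G z| - e < G z z.
Proof.
move=> Gc; rewrite precompactE compact_cover => GK e0.
have [|phi|D D1 KD] := GK E [set x | `|x| <= 1] (fun x => [set phi : dual E | `|phi| - e < phi x]).
- move=> x _; have -> : [set phi : dual E | `|phi| - e < phi x] =
      (fun phi : dual E => phi x - `|phi|) @^-1` [set t | - e < t].
    by apply/seteqP; split=> phi /=; lra.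
  by apply: open_comp; [move=> phi _; exact: deficit_continuous|exact: open_gt].
- by move=> _; have [x [x1 phix]] := dual_norm_almost_attained phi e0; exists x.
have KG z : exists2 x : D, `|\val x| <= 1 & `|G z| - e < G z (\val x).
  have [x /= xD Gx] := KD (G z) (subset_closure (imageP G I)).
  by exists (FSetSub xD) => //=; have := D1 _ xD; rewrite inE.
have [i0 _ _] := KG 0.
have [p [p0 p1 Gp]] := finite_variational_inequality i0 (fun i : D => \val i) Gc.
exists (\sum_i p i *: \val i); split.
  rewrite -p1; apply: le_trans (ler_norm_sum _ _ _) _; apply: ler_sum => i _.
  rewrite normrZ ger0_norm // ler_piMr //.
  by have := D1 _ (valP i); rewrite inE.
have [i _ Gi] := KG (\sum_i p i *: \val i).
exact: lt_le_trans Gi (Gp i).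
Qed.

End Main.

Theorem theorem1 (R : realType) (E : completeNormedModType R)
    (E_infinite : infinite_dimensional E)
    (E_reflexive : reflexive_space E)
    (E_KK : Kadec_Klee E)
    (f : sphere E -> dual E)
    (f_compact : compact_function f)
    (f_inf : 0 < inf [set `|f x| | x in [set: sphere E]]) :
  exists x : sphere E, f x (\val x) = `|f x|.
Proof.
have [f_c f_pre] := f_compact.
have [r [r_c r1 r_id]] := sphere_retraction E_infinite.
pose rs z : sphere E := SigSub (mem_set (r1 z : sphere E (r z))).
have rs_c : continuous rs by apply: continuous_comp_initial.
pose G z := f (rs z).
have G_c : continuous G.
  by move=> z; apply: (continuous_cvg _ (@f_c (rs z))); exact: rs_c.
have G_pre : precompact (range G).
  by apply: precompact_subset f_pre => _ [z _ <-]; exists (rs z).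
set d := inf _ in f_inf.
have G_ge z : d <= `|G z|.
  by apply: ge_inf; [exists 0 => _ [x _ <-]; exact: normr_ge0|exists (rs z)].
have /choice[z zP] (n : nat) : exists z, `|z| <= 1 /\ `|G z| - n.+1%:R^-1 < G z z.
  by apply: almost_norming; rewrite ?invr_gt0.
have [y [s [s_ge zy]]] := weak_sequential_compactness E_reflexive (fun n => (zP n).1).
pose u := z \o s; rewrite -/u in zy.
have u_le k : `|u k| <= 1 := (zP (s k)).1.
have Gu k : `|G (u k)| - k.+1%:R^-1 <= G (u k) (u k).
  apply: le_trans (ltW (zP (s k)).2); rewrite lerD2l lerN2.
  by rewrite lef_pV2 ?posrE // ler_nat ltnS.
have u_ge k : 1 - k.+1%:R^-1 / d <= `|u k|.
  have Gu0 : 0 < `|G (u k)| by apply: lt_le_trans (G_ge _).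
  have h1 : `|G (u k)| - k.+1%:R^-1 <= `|G (u k)| * `|u k|.
    by apply: le_trans (Gu k) (le_trans (ler_norm _) (dual_normP _ _)).
  rewrite -(ler_pM2l Gu0); apply: le_trans h1; rewrite mulrBr mulr1 lerD2l lerN2.
  by rewrite mulrCA ler_peMr ?invr_ge0 // ler_pdivlMr // mul1r.
have u_norm : `|u k| @[k --> \oo] --> (1 : R).
  apply: (@squeeze_cvgr _ _ _ _ (fun k => 1 - k.+1%:R^-1 / d) (fun=> 1)).
  - by apply: nearW => k; rewrite u_ge u_le.
  - suff : 1 - k.+1%:R^-1 / d @[k --> \oo] --> (1 - 0 / d : R) by rewrite mul0r subr0.
    by apply: cvgB; [exact: cvg_cst|apply: cvgMr_tmp; exact: inv_succ_cvg0].
  - exact: cvg_cst.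
have [U [UU ooU]] := ultraFilterLemma (eventually_filter : ProperFilter \oo).
rewrite precompactE in G_pre.
have [phi _ phiU] : exists2 phi, closure (range G) phi & G (u k) @[k --> U] --> phi.
  by apply: ultra_compact => // k; apply: subset_closure; exists (u k).
have phi_ge : d <= `|phi|.
  by apply: (cvgr_to_ge (cvg_norm phiU)); apply: nearW => k; exact: G_ge.
have Guu : G (u k) (u k) @[k --> U] --> (phi y : R).
  apply/cvgrPdist_lt => e e0; have e2 : 0 < e / 2 by rewrite divr_gt0.
  have /cvgrPdist_lt/(_ _ e2) phiU_near := phiU.
  near=> k.
  have h1 : `|phi (u k) - G (u k) (u k)| < e / 2.
    apply: (@le_lt_trans _ _ `|phi - G (u k)|).
      have /= <- := linearB (bidual_eval (u k)) phi (G (u k)).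
      exact: dual_norm_ub (phi - G (u k)) (u k) (u_le k).
    by near: k; exact: phiU_near.
  have h2 : `|phi y - phi (u k)| < e / 2.
    by near: k; apply: ooU; move/cvgrPdist_lt: (zy phi); apply.
  have := ler_normD (phi y - phi (u k)) (phi (u k) - G (u k) (u k)).
  rewrite subrKA; lra.
have phi_y : `|phi| <= phi y.
  have inv0 : (k.+1%:R^-1 : R) @[k --> U] --> (0 : R).
    by apply: cvg_trans (@inv_succ_cvg0 R); exact: cvg_fmap2.
  have lim : `|G (u k)| - k.+1%:R^-1 @[k --> U] --> (`|phi| - 0 : R).
    by apply: cvgB inv0; exact: cvg_norm.
  by rewrite -[leLHS]subr0; apply: (@ler_cvg_to nat U _ R _ _ _ _ lim Guu); exact: nearW.
have y_le : `|y| <= 1.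
  have [psi [psiy psin]] := norming_functional y.
  rewrite -psiy; apply: (cvgr_to_le (zy psi)); apply: nearW => k.
  exact: le_trans (ler_norm _) (le_trans (psin _) (u_le k)).
have y1 : `|y| = 1.
  apply/eqP; rewrite eq_le y_le /= -(ler_pM2l (lt_le_trans f_inf phi_ge)) mulr1.
  exact: le_trans phi_y (le_trans (ler_norm _) (dual_normP _ _)).
have uy : u k @[k --> \oo] --> y by exact: Kadec_Klee_cvg.
have GyE : G y = phi.
  apply: (@norm_cvg_unique R (dual E) (G (u k) @[k --> U])) => //.
  apply: (continuous_cvg _ (@G_c y)).
  by apply: cvg_trans uy; exact: cvg_fmap2.
exists (rs y); rewrite /= r_id // -/(G y) GyE; apply/eqP.
rewrite eq_le phi_y andbT; apply: le_trans (ler_norm _) _.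
by have := dual_normP phi y; rewrite y1 mulr1.
Unshelve. all: by end_near. Qed.
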